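(* Let $(X,\tau,\mathcal{I},\mathfrak{a})$ be an ideal-aura topological space. The operator $\operatorname{cl}^{*}_{\mathfrak{a}}:\mathcal{P}(X)\to\mathcal{P}(X)$ is an additive Čech closure operator; that is, for all $A,B\subseteq X$: (i) $\operatorname{cl}^{*}_{\mathfrak{a}}(\emptyset)=\emptyset$; (ii) $A\subseteq\operatorname{cl}^{*}_{\mathfrak{a}}(A)$; (iii) $A\subseteq B$ implies $\operatorname{cl}^{*}_{\mathfrak{a}}(A)\subseteq\operatorname{cl}^{*}_{\mathfrak{a}}(B)$; (iv) $\operatorname{cl}^{*}_{\mathfrak{a}}(A\cup B)=\operatorname{cl}^{*}_{\mathfrak{a}}(A)\cup\operatorname{cl}^{*}_{\mathfrak{a}}(B)$.
   Context: An ideal on a set $X$ is a non-empty collection $\mathcal{I}\subseteq\mathcal{P}(X)$ closed under taking subsets and finite unions. A scope function on a topological space $(X,\tau)$ is a function $\mathfrak{a}:X\to\tau$ with $x\in\mathfrak{a}(x)$ for every $x\in X$. An ideal-aura topological space $(X,\tau,\mathcal{I},\mathfrak{a})$ is a topological space $(X,\tau)$ with an ideal $\mathcal{I}$ on $X$ and a scope function $\mathfrak{a}:X\to\tau$. For $A\subseteq X$, the aura-local function is $A^{\mathfrak{a}}(\mathcal{I})=\{x\in X:\mathfrak{a}(x)\cap A\notin\mathcal{I}\}$ and the ideal-aura closure is $\operatorname{cl}^{*}_{\mathfrak{a}}(A)=A\cup A^{\mathfrak{a}}(\mathcal{I})$. *)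

(* Defs.v *)
From mathcomp Require Import all_boot.
From mathcomp Require Import all_classical.
From mathcomp Require Import topology.

Set Implicit Arguments.
Unset Strict Implicit.
Unset Printing Implicit Defensive.

Local Open Scope classical_set_scope.

(* Closure under binary unions, together with non-emptiness and closure under
   subsets, gives closure under all finite unions. The ideal need not be
   proper. *)
Record is_ideal (X : Type) (I : set (set X)) : Prop := IsIdeal {
  ideal_nonempty : I !=set0 ;
  ideal_subset : forall A B : set X, A `<=` B -> I B -> I A ;
  ideal_setU : forall A B : set X, I A -> I B -> I (A `|` B)
}.

Record is_scope_function (X : topologicalType) (a : X -> set X) : Prop :=
  IsScopeFunction {
    scope_open : forall x : X, open (a x) ;
    scope_mem : forall x : X, a x x
  }.

Definition aura_local (X : Type) (I : set (set X)) (a : X -> set X)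
  (A : set X) : set X := [set x | ~ I (a x `&` A)].

Definition ideal_aura_closure (X : Type) (I : set (set X)) (a : X -> set X)
  (A : set X) : set X := A `|` aura_local I a A.

Record additive_cech_closure (X : Type) (c : set X -> set X) : Prop :=
  AdditiveCechClosure {
    cech_set0 : c set0 = set0 ;
    cech_extensive : forall A : set X, A `<=` c A ;
    cech_monotone : forall A B : set X, A `<=` B -> c A `<=` c B ;
    cech_setU : forall A B : set X, c (A `|` B) = c A `|` c B
  }.

(* Main.v *)
Require Import Defs.
From mathcomp Require Import all_boot.
From mathcomp Require Import all_classical.
From mathcomp Require Import topology.

Local Open Scope classical_set_scope.

(** The operator [aura_local I a] already fixes the empty set, is monotone and distributes over
    binary unions, and joining it with the identity keeps these properties and adds extensivity. The
    main point is [aura_localU]: intersection with [a x] distributes over the union, and a union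
    lying outside an ideal has a piece outside it. *)

Lemma ideal_set0 (X : Type) (I : set (set X)) : is_ideal I -> I set0.
Proof.
by move=> hI; have [B IB] := ideal_nonempty hI; apply: (ideal_subset hI _ IB).
Qed.

Lemma aura_local0 (X : Type) (I : set (set X)) (a : X -> set X) :
  is_ideal I -> aura_local I a set0 = set0.
Proof.
move=> hI; rewrite -subset0 => x; rewrite /aura_local /= setI0.
by apply; exact: ideal_set0.
Qed.

(** Contrapositive of heredity: if the trace of [B] on [a x] is in [I], so is the smaller trace of
    [A]. *)
Lemma aura_localS (X : Type) (I : set (set X)) (a : X -> set X)
    (A B : set X) :
  is_ideal I -> A `<=` B -> aura_local I a A `<=` aura_local I a B.
Proof.
move=> hI AB x nIA IB; apply: nIA.
by apply: (ideal_subset hI _ IB); exact: setIS.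
Qed.

Lemma aura_localU (X : Type) (I : set (set X)) (a : X -> set X)
    (A B : set X) :
  is_ideal I ->
  aura_local I a (A `|` B) = aura_local I a A `|` aura_local I a B.
Proof.
move=> hI; apply/seteqP; split=> [x|].
  (* Classical De Morgan: it suffices to refute that both traces on [a x] lie in [I]. *)
  rewrite /aura_local /= setIUr => nIAB; apply/not_andP => -[IA IB].
  by apply: nIAB; exact: (ideal_setU hI).
by rewrite subUset; split; exact: aura_localS.
Qed.

Theorem theorem4p2 (X : topologicalType) (I : set (set X)) (a : X -> set X)
    (hI : is_ideal I) (ha : is_scope_function a) :
  additive_cech_closure (ideal_aura_closure I a).
Proof.
split=> [|A|A B AB|A B]; rewrite /ideal_aura_closure.
- by rewrite aura_local0 // setU0.
- exact: subsetUl.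
- by apply: setUSS => //; exact: aura_localS.
(* Regrouping the four-fold union pairs each set with its own local function. *)
- by rewrite aura_localU // setUACA.
Qed.
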